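(* Let $I=[u_1,u_N]$ be a closed bounded interval with a partition $\Delta=\{(u_1,\ldots,u_N): u_1<\cdots<u_N\}$, let $J=\{1,\ldots,N-1\}$, and for $n\in J$ let $I_n=[u_n,u_{n+1}]$. For each $n\in J$ let $L_n:I\to I_n$ be a contractive homeomorphism such that either $L_n(u_1)=u_n$ and $L_n(u_N)=u_{n+1}$, or $L_n(u_1)=u_{n+1}$ and $L_n(u_N)=u_n$. Let $F,S\in\mathcal{C}(I,\mathcal{K}(\mathbb{R}))$ satisfy $S(u_1)-F(u_1)=S(u_N)-F(u_N)$, and let $\alpha\in\mathbb{R}$. If $|\alpha|<1$, then there exists a unique function $F^{\alpha}_{\Delta,S}\in\mathcal{C}(I,\mathcal{K}(\mathbb{R}))$ satisfying the self-referential equation $$F^{\alpha}_{\Delta,S}(u)=F(u)+\alpha\left[F^{\alpha}_{\Delta,S}(L_n^{-1}(u))-S(L_n^{-1}(u))\right]\quad\text{for every } u\in I_n \text{ and every } n\in J.$$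
   Context: $\mathcal{K}(\mathbb{R})$ is the collection of nonempty compact subsets of $\mathbb{R}$, with the Hausdorff metric $H_d(A,B)=\max\{\sup_{a\in A}\inf_{b\in B}|a-b|,\ \sup_{b\in B}\inf_{a\in A}|b-a|\}$. $\mathcal{C}(I,\mathcal{K}(\mathbb{R}))$ is the set of continuous maps $I\to\mathcal{K}(\mathbb{R})$. For $A,B\in\mathcal{K}(\mathbb{R})$ and $\lambda\in\mathbb{R}$: $A+B=\{a+b:a\in A,b\in B\}$ (Minkowski sum), $\lambda A=\{\lambda a:a\in A\}$, and $A-B=A+(-1)B=\{a-b:a\in A,b\in B\}$. *)

(* Defs.v *)
From HB Require Import structures.
From mathcomp Require Import all_boot all_order all_algebra.
From mathcomp Require Import all_classical all_reals all_analysis.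
Set Implicit Arguments.
Unset Strict Implicit.
Unset Printing Implicit Defensive.
Import Order.TTheory GRing.Theory Num.Theory.
Import numFieldNormedType.Exports.
Local Open Scope classical_set_scope.
Local Open Scope ring_scope.

Record compacts (R : realType) := Compacts {
  cset :> set R ;
  cset_neq0 : cset !=set0 ;
  cset_compact : compact cset }.

Lemma compacts_eq (R : realType) (A B : compacts R) :
  cset A = cset B -> A = B.
Proof.
case: A B => [A A0 Ac] [B B0 Bc] /= AB; rewrite AB in A0 Ac *.
by congr Compacts; exact: Prop_irrelevance.
Qed.

Definition excess (R : realType) (A B : set R) : R :=
  sup [set inf [set `|a - b| | b in B] | a in A].

Definition hausdorff_dist (R : realType) (A B : set R) : R :=
  Num.max (excess A B) (excess B A).

Section hausdorff_dist_theory.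
Context {R : realType}.
Implicit Types (A B C : compacts R) (x r : R).

Let gap (B : set R) (x : R) : R := inf [set `|x - b| | b in B].

Let gap_le (B : set R) x b : B b -> gap B x <= `|x - b|.
Proof.
move=> Bb; apply: ge_inf; last by exists b.
by exists 0 => _ [c _ <-].
Qed.

Let gap_ge0 B x : 0 <= gap B x.
Proof.
apply: lb_le_inf; last by move=> _ [c _ <-].
by have [b Bb] := cset_neq0 B; exists `|x - b|, b.
Qed.

Let gap_adherent B x e : 0 < e -> exists2 b, cset B b & `|x - b| < gap B x + e.
Proof.
move=> e0; have [b Bb] := cset_neq0 B.
have [|_ [c Bc <-] lt_c] := inf_adherent (E := [set `|x - b| | b in B]) e0.
  by split; [exists `|x - b|, b|exists 0 => _ [c _ <-]].
by exists c.
Qed.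

Let gap_excess A B x : cset A x -> gap B x <= excess A B.
Proof.
move=> Ax; apply: ub_le_sup; last by exists x.
have [b Bb] := cset_neq0 B.
have [M [_ /(_ (`|M| + 1)) hM]] := compact_bounded (@cset_compact _ A).
exists (`|M| + 1 + `|b|) => _ [a Aa <-].
rewrite (le_trans (gap_le _ Bb))// (le_trans (ler_normB _ _))//.
rewrite lerD2r hM//.
by rewrite (le_lt_trans (ler_norm _))// ltrDl.
Qed.

Let excess_le A B r : (forall x, cset A x -> gap B x <= r) -> excess A B <= r.
Proof.
move=> h; apply: ge_sup; last by move=> _ [a Aa <-]; exact: h.
by have [a Aa] := cset_neq0 A; exists (gap B a), a.
Qed.

Let excess_triangle B A C : excess A C <= excess A B + excess B C.
Proof.
apply: excess_le => a Aa; apply/ler_addgt0Pr => e e0.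
have e20 : 0 < e / 2 by rewrite divr_gt0.
have [b Bb ab] := gap_adherent B a e20.
have [c Cc bc] := gap_adherent C b e20.
rewrite (le_trans (gap_le _ Cc))// (le_trans (ler_distD b _ _))//.
have -> : excess A B + excess B C + e = excess A B + e / 2 + (excess B C + e / 2).
  by rewrite addrACA -splitr.
rewrite lerD//.
  by rewrite (le_trans (ltW ab))// lerD2r gap_excess.
by rewrite (le_trans (ltW bc))// lerD2r gap_excess.
Qed.

Let excess_sub A B : excess A B <= 0 -> cset A `<=` cset B.
Proof.
move=> h a Aa.
have clB : closed (cset B).
  by apply: compact_closed; [exact: norm_hausdorff|exact: cset_compact].
rewrite ((closure_id (cset B)).1 clB) => U /nbhs_ballP[e /= e0 eU].
have [b Bb ab] := gap_adherent B a e0.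
exists b; split => //; apply: eU; rewrite /ball/=.
by rewrite (lt_le_trans ab)// gerDr (le_trans _ h)// gap_excess.
Qed.

Let excessxx A : excess A A = 0.
Proof.
apply/eqP; rewrite eq_le; apply/andP; split.
  by apply: excess_le => x Ax; rewrite (le_trans (gap_le _ Ax))// subrr normr0.
have [x Ax] := cset_neq0 A.
by rewrite (le_trans (gap_ge0 A x))// gap_excess.
Qed.

Lemma hausdorff_distxx A : hausdorff_dist A A = 0.
Proof. by rewrite /hausdorff_dist excessxx maxxx. Qed.

Lemma hausdorff_dist_positivity A B : hausdorff_dist A B = 0 -> A = B.
Proof.
move=> AB; apply: compacts_eq; apply/seteqP.
by split; apply: excess_sub; rewrite -AB le_max lexx ?orbT.
Qed.

Lemma hausdorff_dist_sym A B : hausdorff_dist A B = hausdorff_dist B A.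
Proof. by rewrite /hausdorff_dist maxC. Qed.

Lemma hausdorff_dist_triangle B A C :
  hausdorff_dist A C <= hausdorff_dist A B + hausdorff_dist B C.
Proof.
rewrite ge_max; apply/andP; split.
  by rewrite (le_trans (excess_triangle B _ _))// lerD// le_max lexx.
by rewrite addrC (le_trans (excess_triangle B _ _))// lerD// le_max lexx orbT.
Qed.

End hausdorff_dist_theory.

HB.instance Definition _ (R : realType) := gen_eqMixin (compacts R).
HB.instance Definition _ (R : realType) := gen_choiceMixin (compacts R).
HB.instance Definition _ (R : realType) :=
  @isMetric.Build R (compacts R) (fun A B => hausdorff_dist A B)
    hausdorff_distxx hausdorff_dist_positivity hausdorff_dist_sym
    hausdorff_dist_triangle.

Lemma compacts_mdistE (R : realType) (A B : compacts R) :
  mdist A B = hausdorff_dist A B.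
Proof. by []. Qed.

Lemma minkowski_add_neq0 (R : realType) (A B : compacts R) :
  [set a + b | a in A & b in B] !=set0.
Proof.
have [a Aa] := cset_neq0 A; have [b Bb] := cset_neq0 B.
by exists (a + b), a => //; exists b.
Qed.

Lemma minkowski_add_compact (R : realType) (A B : compacts R) :
  compact [set a + b | a in A & b in B].
Proof.
have -> : [set a + b | a in A & b in B]
        = (fun z : R * R => z.1 + z.2) @` (cset A `*` cset B).
  apply/seteqP; split.
    by move=> _ [a Aa [b Bb <-]]; exists (a, b).
  by move=> _ [[a b] [Aa Bb] <-]; exists a => //; exists b.
apply: continuous_compact.
  by apply: continuous_subspaceT => z; exact: add_continuous.
by apply: compact_setX; exact: cset_compact.
Qed.

Definition minkowski_add (R : realType) (A B : compacts R) : compacts R :=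
  Compacts (minkowski_add_neq0 A B) (@minkowski_add_compact R A B).

Lemma dilate_neq0 (R : realType) (k : R) (A : compacts R) :
  [set k * a | a in A] !=set0.
Proof. by have [a Aa] := cset_neq0 A; exists (k * a), a. Qed.

Lemma dilate_compact (R : realType) (k : R) (A : compacts R) :
  compact [set k * a | a in A].
Proof.
apply: continuous_compact; last exact: cset_compact.
by apply: continuous_subspaceT => z; exact: mulrl_continuous.
Qed.

Definition dilate (R : realType) (k : R) (A : compacts R) : compacts R :=
  Compacts (dilate_neq0 k A) (@dilate_compact R k A).

Declare Scope compacts_scope.
Delimit Scope compacts_scope with K.
Bind Scope compacts_scope with compacts.
Notation "A + B" := (minkowski_add A B) : compacts_scope.
Notation "k *: A" := (dilate k%R A) : compacts_scope.
(* Not inverse to [+]: [A - A] is in general not [{0}]. *)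
Notation "A - B" := (minkowski_add A (dilate (-1)%R B)) : compacts_scope.

(* [pinv A f] is the inverse of [f] restricted to [A]. *)
Definition homeomorphism_on (T : ptopologicalType) (U : topologicalType)
    (A : set T) (B : set U) (f : T -> U) : Prop :=
  [/\ set_bij A B f, {within A, continuous f}
    & {within B, continuous (pinv A f)}].

Definition contractive_on (R : realType) (A : set R) (f : R -> R) : Prop :=
  exists2 q : R, 0 <= q < 1 & q.-lipschitz_A f.

(* Main.v *)
Require Import Defs.
From mathcomp Require Import all_boot all_order all_algebra.
From mathcomp Require Import all_classical all_reals all_analysis.
Set Implicit Arguments.
Unset Strict Implicit.
Unset Printing Implicit Defensive.
Import Order.TTheory GRing.Theory Num.Theory.
Import numFieldNormedType.Exports.
Local Open Scope classical_set_scope.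
Local Open Scope ring_scope.

(** Write [P x = G x - S x] for a candidate [G].  The self-referential equation
    says that [G] is a fixed point of the operator sending [G] to the map equal
    to [F x + alpha *: P ((L n)^-1 x)] on the [n]-th piece of the partition.
    Minkowski addition is nonexpansive and [alpha *: _] is [`|alpha|]-Lipschitz
    for the Hausdorff metric ([mdist_minkowski_add], [mdist_dilate]), so the
    operator contracts the uniform distance by the factor [`|alpha| < 1], and
    Banach's argument applies once a complete space preserved by the operator
    has been found.

    The difficulty is that neighbouring pieces share a node [x], at which the
    two formulas must agree.  Each [L n] sends the endpoints of the interval to
    the endpoints of its piece, so [(L n)^-1 x] is an endpoint of the interval
    in both formulas; they agree as soon as [P] takes the same value at the two
    endpoints.  This endpoint condition defines the space ([admissible]).  It is
    closed under uniform limits, and the hypothesis on [S - F] makes it contain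
    [F] and be preserved by the operator: the image of [G] is
    [F x + alpha *: P (u 1)] at every node, so that subtracting [S] gives
    [(F x - S x) + alpha *: P (u 1)] at both endpoints
    ([admissible_image]).

    Completeness of the hyperspace of compact sets is proved directly
    ([hausdorff_complete]).  Uniqueness holds among all continuous solutions,
    because two of them are at bounded uniform distance and the equation
    contracts this distance. *)

(** * The Hausdorff metric and the Minkowski operations *)

Section hausdorff.
Context {R : realType}.
Implicit Types (A B C D : compacts R) (r x : R).

Lemma nearest_point B x :
  exists2 b, cset B b & forall c, cset B c -> `|x - b| <= `|x - c|.
Proof.
have [|b /set_mem Bb h] := compact_EVT_min (f := fun b => `|x - b|)
    (cset_neq0 B) (@cset_compact _ B).
  apply: continuous_subspaceT => y.
  by apply: cvg_norm; apply: cvgB; [exact: cvg_cst|exact: cvg_id].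
by exists b => // c Bc; apply: h; exact/mem_set.
Qed.

Lemma excess_leP A B r :
  excess A B <= r <->
  forall a, cset A a -> exists2 b, cset B b & `|a - b| <= r.
Proof.
have infE a : exists2 b, cset B b & inf [set `|a - b| | b in B] = `|a - b|.
  have [b Bb bmin] := nearest_point B a; exists b => //.
  apply/eqP; rewrite eq_le; apply/andP; split.
    apply: ge_inf; last by exists b.
    by exists 0 => _ [c _ <-].
  by apply: lb_le_inf => [|_ [c Bc <-]]; [exists `|a - b|, b|exact: bmin].
split=> [AB a Aa|AB].
  have [b Bb bE] := infE a; exists b => //; rewrite -bE (le_trans _ AB)//.
  apply: ub_le_sup; last by exists a.
  have [b0 Bb0] := cset_neq0 B.
  have [M [_ /(_ (`|M| + 1)) hM]] := compact_bounded (@cset_compact _ A).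
  exists (`|M| + 1 + `|b0|) => _ [a' Aa' <-].
  apply: (@le_trans _ _ `|a' - b0|).
    by apply: ge_inf; [exists 0 => _ [c _ <-]|exists b0].
  rewrite (le_trans (ler_normB _ _))// lerD2r hM//.
  by rewrite (le_lt_trans (ler_norm _))// ltrDl.
apply: ge_sup => [|_ [a Aa <-]].
  by have [a Aa] := cset_neq0 A; eexists; exists a.
have [b Bb ab] := AB _ Aa; rewrite (le_trans _ ab)//.
by apply: ge_inf; [exists 0 => _ [c _ <-]|exists b].
Qed.

(** Since nearest points exist in compact sets, the suprema and infima in the
    Hausdorff distance can be traded for an exact point-matching condition,
    with no epsilon; all later estimates go through it. *)
Lemma mdist_leP A B r : mdist A B <= r <->
  (forall a, cset A a -> exists2 b, cset B b & `|a - b| <= r) /\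
  (forall b, cset B b -> exists2 a, cset A a & `|b - a| <= r).
Proof.
rewrite compacts_mdistE /hausdorff_dist ge_max; split.
  by move=> /andP[/excess_leP ? /excess_leP ?].
by move=> [? ?]; apply/andP; split; apply/excess_leP.
Qed.

Lemma mdist_minkowski_add A B C D :
  mdist (A + B)%K (C + D)%K <= mdist A C + mdist B D.
Proof.
have [AC CA] := (mdist_leP A C _).1 (lexx _).
have [BD DB] := (mdist_leP B D _).1 (lexx _).
apply/mdist_leP; split=> _ [a Aa [b Bb <-]].
  have [c Cc ac] := AC _ Aa; have [d Dd bd] := BD _ Bb.
  exists (c + d); first by exists c => //; exists d.
  by rewrite opprD addrACA (le_trans (ler_normD _ _))// lerD.
have [c Cc ac] := CA _ Aa; have [d Dd bd] := DB _ Bb.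
exists (c + d); first by exists c => //; exists d.
by rewrite opprD addrACA (le_trans (ler_normD _ _))// lerD.
Qed.

Lemma mdist_dilate (k : R) A B :
  mdist (k *: A)%K (k *: B)%K <= `|k| * mdist A B.
Proof.
have [AB BA] := (mdist_leP A B _).1 (lexx _).
apply/mdist_leP; split=> _ [a Aa <-].
  have [b Bb ab] := AB _ Aa; exists (k * b); first by exists b.
  by rewrite -mulrBr normrM ler_wpM2l.
have [b Bb ab] := BA _ Aa; exists (k * b); first by exists b.
by rewrite -mulrBr normrM ler_wpM2l.
Qed.

Lemma minkowski_addC A B : (A + B)%K = (B + A)%K.
Proof.
by apply: compacts_eq; apply/seteqP; split=> _ [a Aa [b Bb <-]];
  exists b => //; exists a => //; rewrite addrC.
Qed.

Lemma minkowski_addA A B C : (A + (B + C))%K = (A + B + C)%K.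
Proof.
apply: compacts_eq; apply/seteqP; split.
  move=> _ [a Aa [_ [b Bb [c Cc <-]] <-]].
  exists (a + b); first by exists a => //; exists b.
  by exists c => //; rewrite addrA.
move=> _ [_ [a Aa [b Bb <-]] [c Cc <-]].
exists a => //; exists (b + c); first by exists b => //; exists c.
by rewrite addrA.
Qed.

(** The endpoint hypothesis of the theorem is about [S - F], whereas the
    iteration manipulates [F - S]. *)
Lemma minkowski_opprB A B : (-1 *: (A - B))%K = (B - A)%K.
Proof.
apply: compacts_eq; apply/seteqP; split.
  move=> _ [_ [a Aa [_ [b Bb <-] <-]] <-].
  exists b => //; exists (-1 * a); first by exists a.
  by rewrite !mulN1r opprD opprK addrC.
move=> _ [b Bb [_ [a Aa <-] <-]].
exists (a + -1 * b); last by rewrite !mulN1r opprD opprK addrC.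
by exists a => //; exists (-1 * b) => //; exists b.
Qed.

(** Completeness of the space of compact sets, with an explicit rate.  The limit
    is the intersection [B] of the closed [rho k]-neighbourhoods of the [A k].
    Points of [B] are close to [A k] by construction; conversely a point [a] of
    [A k] is matched within [rho k] by points of all later [A m], and a cluster
    point of these matching points stays within [rho k] of [a] and belongs to
    every neighbourhood, hence to [B]. *)
Lemma hausdorff_complete (A : nat -> compacts R) (rho : nat -> R) :
  (forall k m, (k <= m)%N -> mdist (A k) (A m) <= rho k) ->
  exists B, forall k, mdist (A k) B <= rho k.
Proof.
move=> Arho.
pose nbd k := [set x | exists2 a, cset (A k) a & `|x - a| <= rho k].
have nbd_compact k : compact (nbd k).
  have -> : nbd k = [set a + b | a in A k & b in `[- rho k, rho k]%classic].
    apply/seteqP; split=> [x [a Aa xa]|_ [a Aa [b /= b_le <-]]].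
      exists a => //; exists (x - a); last by rewrite addrC subrK.
      by rewrite /= in_itv/= -ler_norml.
    exists a => //; rewrite addrAC subrr add0r ler_norml.
    by rewrite in_itv in b_le.
  have -> : [set a + b | a in A k & b in `[- rho k, rho k]%classic]
     = (fun z : R * R => z.1 + z.2) @` (cset (A k) `*` `[- rho k, rho k]%classic).
    apply/seteqP; split.
      by move=> _ [a Aa [b Bb <-]]; exists (a, b).
    by move=> _ [[a b] [Aa Bb] <-]; exists a => //; exists b.
  apply: continuous_compact.
    by apply: continuous_subspaceT => z; exact: add_continuous.
  by apply: compact_setX; [exact: cset_compact|exact: segment_compact].
have nbd_closed k : closed (nbd k).
  by apply: compact_closed; [exact: norm_hausdorff|exact: nbd_compact].
pose B := \bigcap_k nbd k.
have B_nbd k a : cset (A k) a -> exists2 c, B c & `|a - c| <= rho k.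
  move=> Aa.
  have /choice[b bP] m : exists b, (k <= m)%N -> cset (A m) b /\ `|a - b| <= rho k.
    have [km|] := leqP k m; last by exists 0.
    have [/(_ _ Aa)[b Ab ab] _] := (mdist_leP _ _ _).1 (Arho _ _ km).
    by exists b.
  have b_ball : (b @ \oo) `[a - rho k, a + rho k]%classic.
    exists k => // m /= km; have [_ abm] := bP _ km.
    by rewrite in_itv/= -ler_distlC.
  have [c [ac cb]] := @segment_compact _ _ _ (b @ \oo) _ b_ball.
  exists c; last by rewrite ler_distlC.
  move=> j _; apply: (nbd_closed j).
  rewrite clusterE in cb; apply: cb.
  exists (maxn j k) => // m /=; rewrite geq_max => /andP[jm km].
  have [Abm _] := bP _ km.
  have [_ /(_ _ Abm)[a' Aa' ba']] := (mdist_leP _ _ _).1 (Arho _ _ jm).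
  by exists a'.
have B_neq0 : B !=set0.
  by have [a Aa] := cset_neq0 (A 0%N); have [c Bc _] := B_nbd 0%N a Aa; exists c.
have B_compact : compact B.
  apply: (subclosed_compact _ (nbd_compact 0%N)); last exact: bigcap_inf.
  by apply: closed_bigI => k _; exact: nbd_closed.
exists (Compacts B_neq0 B_compact) => k; apply/mdist_leP; split=> [a|b Bb].
  exact: B_nbd.
exact: Bb.
Qed.

End hausdorff.

(** * Contractions for the uniform distance *)

Section fixed_point.
Context {R : realType}.

Lemma geometric_le_eps (a c e : R) : 0 <= a < 1 -> 0 < e ->
  exists k : nat, a ^+ k * c <= e.
Proof.
move=> /andP[a0 a1] e0.
have : geometric c a @ \oo --> 0.
  by apply: cvg_geometric; rewrite ger0_norm.
move=> /cvgrPdist_le /(_ e e0)[k _ /(_ k (leqnn k))] /=.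
rewrite sub0r normrN mulrC => h; exists k.
exact: le_trans (ler_norm _) h.
Qed.

(** The contraction property is only asked of the pair [(G, G')]; iterated on
    the initial bound [M], it pushes the distance below [a ^+ k * M] for
    all [k]. *)
Lemma contraction_unique (T : Type) (A : set T) (G G' : T -> compacts R)
    (a M : R) : 0 <= a < 1 ->
  (forall c, (forall x, A x -> mdist (G x) (G' x) <= c) ->
     forall x, A x -> mdist (G x) (G' x) <= a * c) ->
  (forall x, A x -> mdist (G x) (G' x) <= M) ->
  forall x, A x -> G x = G' x.
Proof.
move=> a01 GG' GM x Ax; apply: mdist_positivity; apply/eqP.
rewrite eq_le mdist_ge0 andbT; apply/ler_addgt0Pr => e e0; rewrite add0r.
have [k] := geometric_le_eps M a01 e0; apply: le_trans.
elim: k x Ax => [|k IH] x Ax; first by rewrite expr0 mul1r; exact: GM.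
by rewrite exprS -mulrA; exact: GG'.
Qed.

(** Banach's fixed point theorem for the uniform distance on a set [A].  It is
    stated with bounds [c] that hold at every point of [A], so that no supremum
    has to be formed, and with the closedness of [X] under uniform limits in
    place of a topology on the function space.  The iterates of [F] satisfy
    [mdist (iter k Phi F x) (iter m Phi F x) <= a ^+ k * M / (1 - a)] for
    [k <= m]; the pointwise limits given by [hausdorff_complete] therefore
    converge uniformly. *)
Lemma uniform_contraction_fixed_point (T : Type) (A : set T)
    (X : set (T -> compacts R)) (Phi : (T -> compacts R) -> T -> compacts R)
    (a M : R) (F : T -> compacts R) :
  0 <= a < 1 ->
  (forall G, X G -> X (Phi G)) ->
  (forall G G' c, X G -> X G' ->
     (forall x, A x -> mdist (G x) (G' x) <= c) ->
     forall x, A x -> mdist (Phi G x) (Phi G' x) <= a * c) ->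
  (forall G, (forall e, 0 < e ->
     exists2 G', X G' & forall x, A x -> mdist (G' x) (G x) <= e) -> X G) ->
  X F -> (forall x, A x -> mdist (F x) (Phi F x) <= M) ->
  exists2 G, X G & forall x, A x -> Phi G x = G x.
Proof.
move=> a01 PhiX PhiC Xclosed XF FM; have /andP[a0 a1] := a01.
pose E := M / (1 - a).
have a1' : 1 - a != 0 by rewrite subr_eq0 eq_sym lt_eqF.
(* The bound [E] on the distance from [F] to its iterates is the one that
   reproduces itself under one more step. *)
have EE : M + a * E = E.
  by rewrite -[X in X + _](divfK a1') -/E mulrBr mulr1 (mulrC E) subrK.
pose G_ k := iter k Phi F.
have XG k : X (G_ k) by elim: k => //= k; exact: PhiX.
have start m x : A x -> mdist (F x) (G_ m x) <= E.
  elim: m x => [|m IH] x Ax.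
    rewrite /= mdistxx /E divr_ge0 ?subr_ge0 ?(ltW a1)//.
    exact: le_trans (mdist_ge0 _ _) (FM x Ax).
  apply: le_trans (metric_triangle _ (Phi F x) _) _.
  by rewrite -[leRHS]EE lerD ?FM//; exact: PhiC Ax.
have cauchy k m x : A x -> mdist (G_ k x) (G_ (k + m)%N x) <= a ^+ k * E.
  elim: k x => [|k IH] x Ax; first by rewrite expr0 mul1r; exact: start.
  by rewrite exprS -mulrA; exact: PhiC Ax.
have /choice[G GP] x :
    exists B, A x -> forall k, mdist (G_ k x) B <= a ^+ k * E.
  have [Ax|nAx] := pselect (A x); last by exists (F x).
  have [|B BP] := @hausdorff_complete R (G_ ^~ x) (fun k => a ^+ k * E).
    by move=> k m /subnKC <-; exact: cauchy.
  by exists B.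
have XG' : X G.
  apply: Xclosed => e e0; have [k ke] := geometric_le_eps E a01 e0.
  by exists (G_ k) => // x Ax; exact: le_trans (GP x Ax k) ke.
exists G => // x Ax; apply: mdist_positivity; apply/eqP.
rewrite eq_le mdist_ge0 andbT; apply/ler_addgt0Pr => e e0; rewrite add0r.
have e20 : 0 < e / 2 by rewrite divr_gt0.
have [k ke] := geometric_le_eps E a01 e20.
have ake : a * (a ^+ k * E) <= e / 2.
  apply: le_trans ke; rewrite -[leRHS]mul1r ler_wpM2r ?(ltW a1)//.
  exact: le_trans (mdist_ge0 _ _) (GP x Ax k).
apply: le_trans (metric_triangle _ (G_ k.+1 x) _) _.
rewrite [leRHS]splitr lerD//.
  rewrite metric_sym (le_trans _ ake)//.
  by apply: PhiC Ax => // y Ay; exact: GP.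
by rewrite (le_trans (GP x Ax k.+1))// exprS -mulrA.
Qed.

End fixed_point.

(** * Continuous set-valued maps *)

Section continuity.
Context {R : realType}.
Implicit Types (A B : set R) (F G : R -> compacts R).

Lemma within_continuousP A G : {within A, continuous G} <->
  forall x e, A x -> 0 < e ->
    \forall y \near within A (nbhs x), mdist (G x) (G y) < e.
Proof.
split.
  move=> /subspace_continuousP cG x e Ax.
  exact: (metricType_numDomainType.cvgrPdist_lt _ _).1 (cG x Ax) e.
move=> cG; apply/subspace_continuousP => x Ax.
by apply/metricType_numDomainType.cvgrPdist_lt => e e0; exact: cG.
Qed.

Lemma near_within_mem A (x : R) : \forall y \near within A (nbhs x), A y.
Proof. exact: withinT. Qed.

Lemma within_continuous_minkowski_add A F G :
  {within A, continuous F} -> {within A, continuous G} ->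
  {within A, continuous (fun x => F x + G x)%K}.
Proof.
move=> /within_continuousP cF /within_continuousP cG.
apply/within_continuousP => x e Ax e0.
have e20 : 0 < e / 2 by rewrite divr_gt0.
near=> y; apply: le_lt_trans (mdist_minkowski_add _ _ _ _) _.
by rewrite [ltRHS]splitr ltrD//; near: y; [exact: cF|exact: cG].
Unshelve. all: by end_near. Qed.

Lemma within_continuous_dilate A (k : R) G : {within A, continuous G} ->
  {within A, continuous (fun x => k *: G x)%K}.
Proof.
move=> /within_continuousP cG; apply/within_continuousP => x e Ax e0.
have k0 : 0 < `|k| + 1 by rewrite ltr_wpDl.
near=> y; apply: le_lt_trans (mdist_dilate _ _ _) _.
have : mdist (G x) (G y) < e / (`|k| + 1).
  by near: y; apply: cG => //; rewrite divr_gt0.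
rewrite ltr_pdivlMr// mulrC; apply: le_lt_trans.
by rewrite ler_wpM2r ?mdist_ge0// lerDl.
Unshelve. all: by end_near. Qed.

Lemma within_continuous_uniform_limit A G :
  (forall e, 0 < e -> exists2 G', {within A, continuous G'} &
     forall x, A x -> mdist (G' x) (G x) <= e) ->
  {within A, continuous G}.
Proof.
move=> lim; apply/within_continuousP => x e Ax e0.
have e40 : 0 < e / 2 / 2 by rewrite !divr_gt0.
have [G' /within_continuousP cG' G'G] := lim _ e40.
near=> y; have Ay : A y by near: y; exact: near_within_mem.
rewrite [ltRHS]splitr.
apply: le_lt_trans (metric_triangle _ (G' y) _) _.
have xy : mdist (G' x) (G' y) < e / 2 / 2 by near: y; exact: cG'.
have h : mdist (G x) (G' y) < e / 2.
  apply: le_lt_trans (metric_triangle _ (G' x) _) _.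
  by rewrite [ltRHS]splitr ler_ltD// metric_sym G'G.
rewrite ltr_leD// (le_trans (G'G _ Ay))//.
by rewrite [leRHS]splitr lerDl ltW.
Unshelve. all: by end_near. Qed.

Lemma within_continuous_comp_on A B (p : R -> R) G :
  {within B, continuous p} -> (forall x, B x -> A (p x)) ->
  {within A, continuous G} -> {within B, continuous (G \o p)}.
Proof.
move=> /subspace_continuousP cp pA /subspace_continuousP cG.
apply/subspace_continuousP => x Bx; apply: cvg_comp (cG _ (pA _ Bx)).
move=> U /= /(cp x Bx) /= pU.
near=> y; have By : B y by near: y; exact: near_within_mem.
by move: (pA _ By); near: y; exact: pU.
Unshelve. all: by end_near. Qed.

Lemma within_continuous_bounded A G (K : compacts R) :
  compact A -> {within A, continuous G} ->
  exists M, forall x, A x -> mdist (G x) K <= M.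
Proof.
move=> cA /within_continuousP cG.
have [->|A0] := eqVneq A set0; first by exists 0.
have [||c _ cmax] := compact_EVT_max (f := fun x => mdist (G x) K) _ cA.
- exact/set0P.
- apply/subspace_continuousP => x Ax; apply/cvgrPdist_lt => e e0.
  near=> y.
  have xy : mdist (G x) (G y) < e by near: y; exact: cG.
  rewrite (le_lt_trans _ xy)// ler_distlC.
  have h1 := metric_triangle (G x) (G y) K.
  have h2 := metric_triangle (G y) (G x) K.
  rewrite (metric_sym (G y) (G x)) in h2.
  by rewrite lerBlDr (addrC (mdist (G y) K)) h1 (addrC (mdist (G x) K)) h2.
by exists (mdist (G c) K) => x Ax; apply: cmax; exact/mem_set.
Unshelve. all: by end_near. Qed.

End continuity.

(** * Partitions of an interval *)

Section partition.
Context {R : realType} (N : nat) (u : nat -> R).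
Context (u_incr : forall n, (1 <= n < N)%N -> u n < u n.+1).

Lemma partition_le m n : (1 <= m)%N -> (m <= n <= N)%N -> u m <= u n.
Proof.
move=> m1 /andP[]; elim: n => [|n IH]; first by rewrite leqNgt m1.
rewrite leq_eqVlt => /predU1P[->//|]; rewrite ltnS => mn nN.
rewrite (le_trans (IH mn (ltnW nN)))// ltW// u_incr//.
by rewrite (leq_trans m1 mn).
Qed.

Lemma piece_sub n : (1 <= n < N)%N ->
  `[u n, u n.+1]%classic `<=` `[u 1%N, u N]%classic.
Proof.
move=> /andP[n1 nN] x /=; rewrite !in_itv/= => /andP[unx xun].
rewrite (le_trans _ unx) ?(le_trans xun) ?partition_le ?n1 ?(ltnW nN)//.
by rewrite nN leqnn.
Qed.

Lemma piece_cover x : (2 <= N)%N -> `[u 1%N, u N]%classic x ->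
  exists2 n, (1 <= n < N)%N & `[u n, u n.+1]%classic x.
Proof.
move=> N2 /=; rewrite in_itv/= => /andP[u1x].
suff H m : (2 <= m <= N)%N -> x <= u m ->
    exists2 n, (1 <= n < N)%N & `[u n, u n.+1]%classic x.
  by apply: H; rewrite N2 leqnn.
elim: m => // m IH /andP[]; rewrite ltnS leq_eqVlt => /predU1P[<-|m1] mN xu.
  by exists 1%N => //=; rewrite in_itv/= u1x.
have [xum|umx] := leP x (u m); first by apply: IH => //; rewrite m1 ltnW.
by exists m; rewrite /= ?in_itv/= ?(ltW umx)// (ltnW m1).
Qed.

Lemma piece_overlap m n x : (1 <= m)%N -> (m < n <= N)%N ->
  `[u m, u m.+1]%classic x -> `[u n, u n.+1]%classic x ->
  x = u m.+1 /\ x = u n.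
Proof.
move=> m1 /andP[mn nN] /=; rewrite !in_itv/= => /andP[_ xm] /andP[nx _].
have mn' : u m.+1 <= u n by rewrite partition_le// mn.
split; apply/eqP; rewrite eq_le.
  by rewrite xm (le_trans mn').
by rewrite nx (le_trans xm).
Qed.

Lemma within_continuous_pieces (U : topologicalType) (G : R -> U) :
  (2 <= N)%N ->
  (forall n, (1 <= n < N)%N ->
     {within `[u n, u n.+1]%classic, continuous G}) ->
  {within `[u 1%N, u N]%classic, continuous G}.
Proof.
move=> N2 cG.
suff H m : (2 <= m <= N)%N -> {within `[u 1%N, u m]%classic, continuous G}.
  by apply: H; rewrite N2 leqnn.
elim: m => // m IH /andP[]; rewrite ltnS leq_eqVlt => /predU1P[<-|m1] mN.
  exact: cG.
have -> : `[u 1%N, u m.+1]%classic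
    = `[u 1%N, u m]%classic `|` `[u m, u m.+1]%classic.
  apply/seteqP; split=> x /=; rewrite !in_itv/=.
    move=> /andP[-> ->]; rewrite andbT.
    by have [|/ltW] := leP x (u m); [left|right].
  have u1m : u 1%N <= u m by rewrite partition_le// (ltnW m1) ltnW.
  have umS : u m <= u m.+1 by rewrite partition_le ?leqnSn// ltnW.
  move=> [/andP[-> xm]|/andP[mx ->]]; first exact: le_trans umS.
  by rewrite (le_trans u1m mx).
apply: withinU_continuous; [exact: itv_closed|exact: itv_closed| |].
  by apply: IH; rewrite m1 ltnW.
by apply: cG; rewrite (ltnW m1).
Qed.

End partition.

(** * The self-referential operator *)

Section maps_onto_pieces.
Context {R : realType} (N : nat) (u : nat -> R) (L : nat -> R -> R).
Local Notation I := `[u 1%N, u N]%classic.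
Local Notation I_ n := `[u n, u n.+1]%classic.
Context (N2 : (2 <= N)%N) (u_incr : forall n, (1 <= n < N)%N -> u n < u n.+1).
Context (L_homeo : forall n, (1 <= n < N)%N -> homeomorphism_on I (I_ n) (L n)).
Context (L_ends : forall n, (1 <= n < N)%N ->
  (L n (u 1%N) = u n /\ L n (u N) = u n.+1) \/
  (L n (u 1%N) = u n.+1 /\ L n (u N) = u n)).

Lemma mem_first : I (u 1%N).
Proof. by rewrite /= in_itv/= lexx (partition_le u_incr)//= ltnW//=. Qed.

Lemma mem_last : I (u N).
Proof. by rewrite /= in_itv/= lexx (partition_le u_incr)//= ltnW//=. Qed.

Lemma pinv_piece n x : (1 <= n < N)%N -> I_ n x -> I (pinv I (L n) x).
Proof.
move=> nN Ix; have [[_ _ surj] _ _] := L_homeo nN.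
by apply: (surjpinv_image_sub surj); exists x.
Qed.

Lemma pinv_node n x : (1 <= n < N)%N -> x = u n \/ x = u n.+1 ->
  pinv I (L n) x = u 1%N \/ pinv I (L n) x = u N.
Proof.
move=> nN xn; have [[_ inj _] _ _] := L_homeo nN.
have LK t : I t -> pinv I (L n) (L n t) = t.
  by move=> It; apply: pinvKV inj _ _; exact/mem_set.
have := L_ends nN; have := LK _ mem_first; have := LK _ mem_last.
by case: xn => -> KN K1 [[E1 EN]|[E1 EN]]; rewrite E1 in K1; rewrite EN in KN;
  auto.
Qed.

Context (F S : R -> compacts R) (alpha : R).
Context (cF : {within I, continuous F}) (cS : {within I, continuous S}).
Context (FS : (S (u 1%N) - F (u 1%N))%K = (S (u N) - F (u N))%K).

(** The condition on endpoints is exactly what makes the formulas of two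
    neighbouring pieces agree at their common node. *)
Definition admissible (G : R -> compacts R) : Prop :=
  {within I, continuous G} /\ (G (u 1%N) - S (u 1%N))%K = (G (u N) - S (u N))%K.

(** The Read-Bajraktarevic operator.  At each point it uses an arbitrarily
    chosen piece containing that point; on admissible functions the value does not
    depend on the choice, because two candidate pieces share only a node, which
    both inverse maps send to an endpoint of the whole interval. *)
Lemma read_bajraktarevic_exists :
  exists Phi : (R -> compacts R) -> R -> compacts R,
  (forall G n x, admissible G -> (1 <= n < N)%N -> I_ n x ->
     Phi G x = (F x + alpha *: (G (pinv I (L n) x) - S (pinv I (L n) x)))%K) /\
  (forall G G' c, (forall x, I x -> mdist (G x) (G' x) <= c) ->
     forall x, I x -> mdist (Phi G x) (Phi G' x) <= `|alpha| * c).
Proof.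
have /choice[i iP] x : exists n, I x -> (1 <= n < N)%N /\ I_ n x.
  have [/(piece_cover N2)[n nN xn]|nIx] := pselect (I x); last by exists 0%N.
  by exists n.
pose h x := pinv I (L (i x)) x.
exists (fun G x => (F x + alpha *: (G (h x) - S (h x)))%K); split.
  move=> G n x [_ Gends] nN xn.
  have [iN xi] := iP x (piece_sub u_incr nN xn).
  suff -> : (G (h x) - S (h x))%K
      = (G (pinv I (L n) x) - S (pinv I (L n) x))%K by [].
  have nodes : (x = u n \/ x = u n.+1) -> (x = u (i x) \/ x = u (i x).+1) ->
      (G (h x) - S (h x))%K = (G (pinv I (L n) x) - S (pinv I (L n) x))%K.
    move=> /(pinv_node nN) nE /(pinv_node iN) iE.
    by rewrite /h; case: nE => ->; case: iE => ->.
  have [/andP[n1 nN'] /andP[i1 iN']] := (nN, iN).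
  have [ni|ni|ni] := ltngtP n (i x).
  - have ni' : (n < i x <= N)%N by rewrite ni ltnW.
    have [xE xE'] := piece_overlap u_incr n1 ni' xn xi.
    by apply: nodes; [right|left].
  - have ni' : (i x < n <= N)%N by rewrite ni ltnW.
    have [xE xE'] := piece_overlap u_incr i1 ni' xi xn.
    by apply: nodes; [left|right].
  - by rewrite /h -ni.
move=> G G' c GG' x Ix; have [iN xi] := iP x Ix.
apply: le_trans (mdist_minkowski_add _ _ _ _) _; rewrite mdistxx add0r.
apply: le_trans (mdist_dilate _ _ _) _; rewrite ler_wpM2l//.
apply: le_trans (mdist_minkowski_add _ _ _ _) _; rewrite mdistxx addr0.
by apply: GG'; exact: pinv_piece.
Qed.

(** Continuity is checked on each piece, where the formula is a composition of
    continuous maps.  At the nodes the formula reduces to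
    [F x + alpha *: (G (u 1%N) - S (u 1%N))], so the endpoint condition for
    [Phi] follows from the one for [F]. *)
Lemma admissible_image (G Phi : R -> compacts R) : admissible G ->
  (forall n x, (1 <= n < N)%N -> I_ n x ->
     Phi x = (F x + alpha *: (G (pinv I (L n) x) - S (pinv I (L n) x)))%K) ->
  admissible Phi.
Proof.
move=> [cG Gends] PhiE; split.
  apply: (within_continuous_pieces u_incr N2) => n nN.
  apply: (@subspace_eq_continuous _ _ _
    (fun x => F x + alpha *: (G (pinv I (L n) x) - S (pinv I (L n) x)))%K Phi).
    by move=> x /set_mem xn; rewrite (PhiE n).
  have [_ _ cp] := L_homeo nN.
  have pI x : I_ n x -> I (pinv I (L n) x) by exact: pinv_piece.
  apply: within_continuous_minkowski_add.
    by apply: continuous_subspaceW cF; exact: piece_sub.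
  apply: within_continuous_dilate; apply: within_continuous_minkowski_add.
    exact: within_continuous_comp_on cp pI cG.
  apply: within_continuous_dilate.
  exact: within_continuous_comp_on cp pI cS.
have node n x : (1 <= n < N)%N -> x = u n \/ x = u n.+1 ->
    Phi x = (F x + alpha *: (G (u 1%N) - S (u 1%N)))%K.
  move=> nN xn.
  have u_le := ltW (u_incr nN).
  rewrite (PhiE n)//; last by case: xn => ->; rewrite /= in_itv/= lexx u_le.
  by have [->|->] := pinv_node nN xn; rewrite ?Gends.
rewrite (node 1%N _ _ (or_introl erefl))//.
have N1 : (1 <= N.-1 < N)%N by rewrite -ltnS prednK ?N2 ?leqnn// ltnW.
rewrite (node N.-1 (u N) N1); last by right; rewrite prednK// ltnW.
rewrite [RHS]minkowski_addC [LHS]minkowski_addC !minkowski_addA.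
by rewrite !(minkowski_addC (-1 *: S _)%K) -!(minkowski_opprB (S _)) FS.
Qed.

End maps_onto_pieces.

Theorem theorem3p2 (R : realType) (N : nat) (u : nat -> R)
    (L : nat -> R -> R) (F S : R -> compacts R) (alpha : R) :
  let I : set R := `[u 1%N, u N]%classic in
  let I_ n : set R := `[u n, u n.+1]%classic in
  (2 <= N)%N ->
  (forall n, (1 <= n < N)%N -> u n < u n.+1) ->
  (forall n, (1 <= n < N)%N ->
    [/\ homeomorphism_on I (I_ n) (L n),
        contractive_on I (L n)
      & (L n (u 1%N) = u n /\ L n (u N) = u n.+1) \/
        (L n (u 1%N) = u n.+1 /\ L n (u N) = u n)]) ->
  {within I, continuous F} ->
  {within I, continuous S} ->
  (S (u 1%N) - F (u 1%N))%K = (S (u N) - F (u N))%K ->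
  `|alpha| < 1 ->
  let self_referential (G : R -> compacts R) :=
    forall n x, (1 <= n < N)%N -> x \in I_ n ->
      G x = (F x + alpha *: (G (pinv I (L n) x) - S (pinv I (L n) x)))%K in
  exists G : R -> compacts R,
    [/\ {within I, continuous G}, self_referential G
      & forall G' : R -> compacts R,
          {within I, continuous G'} -> self_referential G' ->
          {in I, G' =1 G}].
Proof.
move=> I I_ N2 u_incr HL cF cS FS alpha1 self_ref.
have L_homeo n : (1 <= n < N)%N -> homeomorphism_on I (I_ n) (L n).
  by case/HL.
have L_ends n : (1 <= n < N)%N ->
    (L n (u 1%N) = u n /\ L n (u N) = u n.+1) \/
    (L n (u 1%N) = u n.+1 /\ L n (u N) = u n) by case/HL.
have a01 : 0 <= `|alpha| < 1 by rewrite normr_ge0.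
have bounded (G G' : R -> compacts R) : {within I, continuous G} ->
    {within I, continuous G'} ->
    exists M, forall x, I x -> mdist (G x) (G' x) <= M.
  move=> cG cG'; pose K := F 0.
  have [M1 h1] := within_continuous_bounded K (@segment_compact _ _ _) cG.
  have [M2 h2] := within_continuous_bounded K (@segment_compact _ _ _) cG'.
  exists (M1 + M2) => x Ix; apply: le_trans (metric_triangle _ K _) _.
  by rewrite lerD ?h1// metric_sym h2.
have [Phi [PhiE PhiC]] :=
  read_bajraktarevic_exists N2 u_incr L_homeo L_ends F S alpha.
have PhiX G : admissible N u S G -> admissible N u S (Phi G).
  move=> XG; apply: (admissible_image N2 u_incr L_homeo L_ends cF cS FS XG).
  by move=> n x; exact: PhiE.
have XF : admissible N u S F.
  by split => //; rewrite -!(minkowski_opprB (S _)) FS.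
have [M FM] := bounded _ _ cF (PhiX F XF).1.
have Xclosed G : (forall e, 0 < e -> exists2 G', admissible N u S G' &
    forall x, I x -> mdist (G' x) (G x) <= e) -> admissible N u S G.
  move=> lim; split.
    apply: within_continuous_uniform_limit => e /lim[G' [cG' _] G'G].
    by exists G'.
  apply: mdist_positivity; apply/eqP; rewrite eq_le mdist_ge0 andbT.
  apply/ler_addgt0Pr => e e0; rewrite add0r.
  have e20 : 0 < e / 2 by rewrite divr_gt0.
  have [G' [_ G'ends] G'G] := lim _ e20.
  have Gd x : I x -> mdist (G' x - S x)%K (G x - S x)%K <= e / 2.
    move=> Ix; apply: le_trans (mdist_minkowski_add _ _ _ _) _.
    by rewrite mdistxx addr0 G'G.
  apply: le_trans (metric_triangle _ (G' (u 1%N) - S (u 1%N))%K _) _.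
  rewrite [leRHS]splitr lerD//.
    by rewrite metric_sym Gd//; exact: mem_first.
  by rewrite G'ends Gd//; exact: mem_last.
have [G XG GPhi] := uniform_contraction_fixed_point a01 PhiX
  (fun G G' c _ _ => @PhiC G G' c) Xclosed XF FM.
have selfG : self_ref G.
  move=> n x nN /set_mem xn; rewrite -GPhi; first exact: PhiE.
  exact: (piece_sub u_incr nN).
exists G; split => //; first exact: XG.1.
move=> G' cG' selfG' x /set_mem Ix.
have [M' GM'] := bounded _ _ cG' XG.1.
apply: (contraction_unique a01 _ GM') Ix => c GG' {}x Ix.
have [n nN xn] := piece_cover N2 Ix.
rewrite (selfG' n x nN (mem_set xn)) (selfG n x nN (mem_set xn)).
apply: le_trans (mdist_minkowski_add _ _ _ _) _; rewrite mdistxx add0r.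
apply: le_trans (mdist_dilate _ _ _) _; rewrite ler_wpM2l//.
apply: le_trans (mdist_minkowski_add _ _ _ _) _; rewrite mdistxx addr0.
by apply: GG'; exact: (pinv_piece L_homeo nN xn).
Qed.
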